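(* Let $p$ be an odd prime, let $\chi$ be a Dirichlet character with odd conductor $f=f_\chi$, and let $F$ be a positive odd integer which is a multiple of both $p$ and $f$. Then for $s\in\mathbb Z_p$, $$\ell_{p,E}(s,\chi)=\sum_{\substack{a=1\\ p\nmid a}}^{F}(-1)^a\chi(a)H_p(s,a,F),$$ where for $a\in\mathbb Z_p^\times$, $s\in\mathbb Z_p$ and $p\mid F$, $$H_p(s,a,F)=\langle a\rangle^{1-s}\sum_{k=0}^\infty\binom{1-s}{k}\left(\frac Fa\right)^kE_k,$$ and $H_p(s,a,F)$ is an analytic function of $s\in\mathbb Z_p$.
   Context: The Euler numbers $E_k$ are defined by $\frac{2}{e^t+1}=\sum_{k\ge0}E_k\frac{t^k}{k!}$. Set $\chi(a)=0$ if $\gcd(a,f)>1$. Let $\omega$ be the Teichmüller character mod $p$ (for $a\in\mathbb Z_p^\times$, $\omega(a)$ is the $(p-1)$-st root of unity congruent to $a$ mod $p$) and $\langle a\rangle=\omega^{-1}(a)a$. The $p$-adic Euler $\ell$-function is $\ell_{p,E}(s,\chi)=\lim_{N\to\infty}\sum_{a=1,\,p\nmid a}^{fp^N}(-1)^a\chi(a)\langle a\rangle^{1-s}$. *)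

(* Defs.v *)
(* p-adic setting modelled by an abstract complete
   non-archimedean absolute value on a field K with 0 < |p| < 1
   (so K is a complete extension of Q_p, e.g. C_p). *)
From HB Require Import structures.
From mathcomp Require Import all_boot all_order all_algebra.
From mathcomp Require Import reals.
From Stdlib Require Import ClassicalEpsilon.
Set Implicit Arguments. Unset Strict Implicit. Unset Printing Implicit Defensive.
Import Order.TTheory GRing.Theory Num.Theory.
Local Open Scope ring_scope.

Section Padic.
Variables (K : fieldType) (R : realType) (nrm : K -> R).

Definition cvgK (u : nat -> K) (l : K) : Prop :=
  forall e : R, 0 < e -> exists N : nat, forall n, (N <= n)%N -> nrm (u n - l) < e.

Definition cauchyK (u : nat -> K) : Prop :=
  forall e : R, 0 < e -> exists N : nat,
    forall m n, (N <= m)%N -> (N <= n)%N -> nrm (u m - u n) < e.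

(* the limit (a chosen one; meaningful when the sequence converges) *)
Definition limK (u : nat -> K) : K := epsilon (inhabits 0) (fun l => cvgK u l).

Definition seriesK (u : nat -> K) : K := limK (fun n => \sum_(k < n) u k).

Definition is_padic_int (s : K) : Prop :=
  exists u : nat -> int, cvgK (fun n => (u n)%:~R) s.

Definition binomK (x : K) (k : nat) : K :=
  (\prod_(i < k) (x - i%:R)) / (k`!)%:R.

Definition teich (p : nat) (a : K) : K :=
  epsilon (inhabits 0) (fun w => w ^+ (p.-1) = 1 /\ nrm (w - a) < 1).

Definition bracket (p : nat) (a : K) : K := (teich p a)^-1 * a.

(* y^x for |y - 1| < 1 and x in Z_p, via the binomial series *)
Definition ppow (y x : K) : K :=
  seriesK (fun k => binomK x k * (y - 1) ^+ k).

End Padic.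

Record padic_abs (p : nat) (K : fieldType) (R : realType) (nrm : K -> R) : Prop := {
  abs_ge0 : forall x, 0 <= nrm x;
  abs_eq0 : forall x, (nrm x == 0) = (x == 0);
  absM : forall x y, nrm (x * y) = nrm x * nrm y;
  abs_ultra : forall x y, nrm (x + y) <= Num.max (nrm x) (nrm y);
  abs_p : 0 < nrm (p%:R) < 1;
  abs_complete : forall u, cauchyK nrm u -> exists l, cvgK nrm u l
}.

(* Euler numbers: 2/(e^t+1) = sum E_k t^k/k!.  Comparing coefficients in
   2 = (e^t + 1) * sum_k E_k t^k/k! gives E_0 = 1 and, for n >= 1,
   sum_(j<=n) C(n,j) E_j + E_n = 0, i.e. E_n = -1/2 sum_(j<n) C(n,j) E_j. *)
Fixpoint euler_aux (n : nat) : seq rat :=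
  match n with
  | 0 => [:: 1]
  | m.+1 =>
      let s := euler_aux m in
      rcons s (- (1/2) * \sum_(j < m.+1) ('C(m.+1, j))%:R * nth 0 s j)
  end.
Definition eulerE (k : nat) : rat := nth 0 (euler_aux k) k.

Definition dirichlet_char (K : fieldType) (f : nat) (chi : nat -> K) : Prop :=
  [/\ (0 < f)%N,
      forall a, chi (a + f)%N = chi a,
      forall a b, chi (a * b)%N = chi a * chi b,
      chi 1%N = 1
    & forall a, (chi a == 0) = ~~ coprime a f].

(* f is the conductor of chi : chi is primitive modulo f *)
Definition primitive_char (K : fieldType) (f : nat) (chi : nat -> K) : Prop :=
  forall d, (d %| f)%N -> (d < f)%N ->
    exists a b, [/\ coprime a f, coprime b f, a = b %[mod d] & chi a != chi b].

Definition Hp (K : fieldType) (R : realType) (nrm : K -> R) (p : nat)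
    (s a : K) (F : nat) : K :=
  ppow nrm (bracket nrm p a) (1 - s) *
  seriesK nrm (fun k => binomK (1 - s) k * (F%:R / a) ^+ k * ratr (eulerE k)).

(* partial sums defining the p-adic Euler l-function *)
Definition ellE_partial (K : fieldType) (R : realType) (nrm : K -> R) (p f : nat)
    (chi : nat -> K) (s : K) (N : nat) : K :=
  \sum_(1 <= a < (f * p ^ N).+1 | ~~ (p %| a)%N)
     (-1) ^+ a * chi a * ppow nrm (bracket nrm p a%:R) (1 - s).

(* Main.v *)
Require Import Defs.
From HB Require Import structures.
From mathcomp Require Import all_boot all_order all_algebra cyclic.
From mathcomp Require Import reals.
From mathcomp Require Import ring lra zify.
From Stdlib Require Import ClassicalEpsilon FunctionalExtensionality PropExtensionality.
Import Order.TTheory GRing.Theory Num.Theory.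
Set Implicit Arguments. Unset Strict Implicit. Unset Printing Implicit Defensive.
Local Open Scope ring_scope.

(** Cut the sum over [1 <= a <= M n] (with [M], [n] odd, [pf | M]) into [n] blocks
of length [M].  Since [<a + jM> = <a> (1 + jM/a)] and [y |-> y^x] is multiplicative,
it becomes [sum_(a <= M) (-1)^a chi(a) <a>^x U(n, M/a)], where [x = 1 - s] and
[U(n, z) = sum_(j < n) (-1)^j (1 + jz)^x].  Expanding binomially,
[U(n, z) = sum_k binom(x, k) z^k (sum_(j < n) (-1)^j j^k)], and the inner sums are
within [|n|] of [E_k], uniformly in [k], because both satisfy the same recurrence up
to the term [n^k].  Hence [U(n, z)] is within [|n|] of the series in [H_p], while
trivially [|U(n, z) - 1| <= |z|].  Take [(M, n) = (F, p^N)] for the first estimate and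
[(f p^N, F / f)] for the second: both have [M n = F p^N].

For analyticity, [<a> - 1] and [F/a] are divisible by [p] and [v_p(k!) <= k/2], so
both factors of [H_p] are limits of integral polynomials in [s] for the Gauss norm. *)

(** * Elementary bounds: geometric decay and the valuation of factorials *)

Lemma expr_small (R : realType) (r e : R) :
  0 <= r -> r < 1 -> 0 < e ->
  exists N : nat, forall n : nat, (N <= n)%N -> r ^+ n < e.
Proof.
move=> r0 r1 e0.
have [->|rn0] := eqVneq r 0.
  by exists 1%N => -[//|n] _; rewrite exprS mul0r.
have rp : 0 < r by rewrite lt_def rn0.
pose h := r^-1 - 1.
have hp : 0 < h by rewrite subr_gt0 invf_gt1.
(* Bernoulli's inequality for [r^-1 = 1 + h]; the archimedean property then makes [1 + n h] exceed
   [e^-1]. *)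
have bern n : 1 + h *+ n <= (r^-1) ^+ n.
  elim: n => [|n IH]; first by rewrite mulr0n addr0 expr0.
  have -> : r^-1 ^+ n.+1 = (1 + h) * r^-1 ^+ n by rewrite exprS /h; ring.
  apply: (@le_trans _ _ ((1 + h) * (1 + h *+ n))).
    have : 0 <= h *+ n by apply: mulrn_wge0; exact: ltW.
    by rewrite mulrS; nra.
  by rewrite ler_wpM2l // addr_ge0 // ltW.
have x0 : 0 <= e^-1 / h by rewrite divr_ge0 // ltW // invr_gt0.
exists (Num.Def.archi_bound (e^-1 / h)) => n Nn.
have : e^-1 / h < n%:R by apply: (lt_le_trans (archi_boundP x0)); rewrite ler_nat.
rewrite ltr_pdivrMr // mulr_natl => lt_n.
have {lt_n} : e^-1 < (r ^+ n)^-1.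
  by rewrite -exprVn; apply: (lt_le_trans lt_n); apply: le_trans (bern n); rewrite lerDr.
by rewrite ltf_pV2 // posrE exprn_gt0.
Qed.

(** Legendre's formula, one quotient at a time: with [q = k %/ p], induction on the number of terms
    bounds the doubled sum by [2 q + q], and [3 q <= p q <= k]. *)
Lemma logn_fact_double_le (p n : nat) : prime p -> odd p -> ((logn p n`!).*2 <= n)%N.
Proof.
move=> p_pr p_odd; rewrite logn_fact //.
suff H m k : (2 * (\sum_(1 <= i < m.+1) k %/ p ^ i) <= k)%N by rewrite -mul2n.
have p3 : (3 <= p)%N by have := prime_gt1 p_pr; lia.
elim: m k => [|m IH] k; first by rewrite big_geq.
rewrite big_nat_recl // expn1.
have -> : (\sum_(1 <= i < m.+1) k %/ p ^ i.+1 = \sum_(1 <= i < m.+1) (k %/ p) %/ p ^ i)%N.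
  by apply: eq_bigr => i _; rewrite expnS divnMA.
have := IH (k %/ p)%N; have := leq_trunc_div k p.
by nia.
Qed.

(** * Euler numbers and their images in a field of characteristic zero *)

Section EulerNumbers.

Lemma size_euler_aux n : size (euler_aux n) = n.+1.
Proof. by elim: n => //= n IH; rewrite size_rcons IH. Qed.

Lemma nth_euler_aux n j : (j <= n)%N -> nth 0 (euler_aux n) j = eulerE j.
Proof.
elim: n => [|n IH]; first by rewrite leqn0 => /eqP ->.
rewrite leq_eqVlt => /predU1P[-> //|ltj].
by rewrite /= nth_rcons size_euler_aux ltj IH.
Qed.

Lemma eulerE_recurrence n :
  eulerE n.+1 = - (1/2) * \sum_(j < n.+1) ('C(n.+1, j))%:R * eulerE j.
Proof.
rewrite {1}/eulerE /= nth_rcons size_euler_aux ltnn eqxx; congr (_ * _).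
by apply: eq_bigr => j _; rewrite nth_euler_aux // -ltnS.
Qed.

Variable (K : fieldType).
Hypothesis char0 : forall n : nat, (0 < n)%N -> n%:R != 0 :> K.

Let intr_neq0 (z : int) : z != 0 -> z%:~R != 0 :> K.
Proof.
case: z => n nz; first by apply: char0; move: nz; case: n.
by rewrite NegzE mulrNz oppr_eq0; apply: char0.
Qed.

(** [ratr] reads the reduced numerator and denominator; characteristic zero allows
    cross-multiplication with the unreduced ones, and the resulting identity of integers is checked
    in [rat]. *)
Lemma ratr_div (m n : int) : n != 0 -> ratr (m%:~R / n%:~R) = m%:~R / n%:~R :> K.
Proof.
move=> nz; set x := _ / _; rewrite /ratr.
have dz : (denq x)%:~R != 0 :> K by rewrite intr_neq0 ?denq_neq0.
apply/eqP; rewrite eqr_div ?intr_neq0 // -!intrM; apply/eqP; congr (_%:~R).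
apply: (@intr_inj rat); rewrite !intrM.
have : (numq x)%:~R / (denq x)%:~R = x by rewrite divq_num_den.
have dq : (denq x)%:~R != 0 :> rat by rewrite intr_eq0 denq_neq0.
have nq : n%:~R != 0 :> rat by rewrite intr_eq0.
by move/eqP; rewrite /x eqr_div // => /eqP.
Qed.

Lemma ratr_charD (x y : rat) : ratr (x + y) = ratr x + ratr y :> K.
Proof.
have dx := denq_neq0 x; have dy := denq_neq0 y.
rewrite -[x]divq_num_den -[y]divq_num_den addf_div ?intr_eq0 //.
rewrite -!intrM -intrD !ratr_div ?mulf_neq0 //.
by rewrite addf_div ?intr_neq0 // intrD !intrM.
Qed.

Lemma ratr_charM (x y : rat) : ratr (x * y) = ratr x * ratr y :> K.
Proof.
have dx := denq_neq0 x; have dy := denq_neq0 y.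
rewrite -[x]divq_num_den -[y]divq_num_den mulf_div.
by rewrite -!intrM !ratr_div ?mulf_neq0 // mulf_div !intrM.
Qed.

(** Denominators are cleared so that the recurrence can be compared term by term with that of the
    alternating power sums. *)
Lemma ratr_eulerE_recurrence n :
  2 * ratr (eulerE n.+1) = - \sum_(j < n.+1) ('C(n.+1, j))%:R * ratr (eulerE j) :> K.
Proof.
rewrite eulerE_recurrence.
have -> : - (1 / 2) = (-1)%:~R / 2%:~R :> rat by rewrite mulN1r div1r.
rewrite ratr_charM ratr_div // mulrA.
have -> : 2 * ((-1)%:~R / 2%:~R) = -1 :> K.
  by rewrite mulrCA mulfV ?mulr1 //; apply: (char0 (n := 2)).
rewrite mulN1r; congr (- _).
rewrite (big_morph _ ratr_charD (ratr_nat K 0)).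
by apply: eq_bigr => j _; rewrite ratr_charM ratr_nat.
Qed.

End EulerNumbers.

(** * Ultrametric calculus *)

Section AbsoluteValue.

Variables (K : fieldType) (R : realType) (nrm : K -> R) (p : nat).
Hypothesis absK : padic_abs p nrm.

Lemma nrm_ge0 x : 0 <= nrm x. Proof. exact: abs_ge0 absK x. Qed.
Lemma nrmM x y : nrm (x * y) = nrm x * nrm y. Proof. exact: absM absK x y. Qed.
Lemma nrm_eq0 x : (nrm x == 0) = (x == 0). Proof. exact: abs_eq0 absK x. Qed.

Lemma nrm0 : nrm 0 = 0. Proof. by apply/eqP; rewrite nrm_eq0. Qed.

Lemma nrm_gt0 x : (0 < nrm x) = (x != 0).
Proof. by rewrite lt_def nrm_ge0 andbT nrm_eq0. Qed.

Lemma nrm1 : nrm 1 = 1.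
Proof.
have n0 : nrm 1 != 0 by rewrite nrm_eq0 oner_eq0.
by apply: (mulfI n0); rewrite -nrmM !mulr1.
Qed.

Lemma nrmX x n : nrm (x ^+ n) = nrm x ^+ n.
Proof. by elim: n => [|n IH]; rewrite ?expr0 ?nrm1 // !exprS nrmM IH. Qed.

Lemma nrm_expr_eq1 x n : (0 < n)%N -> x ^+ n = 1 -> nrm x = 1.
Proof.
move=> n0 /(congr1 nrm); rewrite nrmX nrm1 => /eqP.
by rewrite pexpr_eq1 ?nrm_ge0 // => /eqP.
Qed.

Lemma nrmN x : nrm (- x) = nrm x.
Proof.
have nN1 : nrm (- 1) = 1 by apply: (@nrm_expr_eq1 _ 2) => //; rewrite sqrrN expr1n.
by rewrite -mulN1r nrmM nN1 mul1r.
Qed.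

Lemma nrm_distC x y : nrm (x - y) = nrm (y - x).
Proof. by rewrite -nrmN opprB. Qed.

Lemma nrmV x : nrm x^-1 = (nrm x)^-1.
Proof.
have [->|x0] := eqVneq x 0; first by rewrite invr0 nrm0 invr0.
have n0 : nrm x != 0 by rewrite nrm_eq0.
by apply: (mulfI n0); rewrite -nrmM !mulfV ?nrm1.
Qed.

Lemma nrmD_le x y B : nrm x <= B -> nrm y <= B -> nrm (x + y) <= B.
Proof. by move=> xB yB; apply: le_trans (abs_ultra absK x y) _; rewrite ge_max xB. Qed.

Lemma nrmD_lt x y B : nrm x < B -> nrm y < B -> nrm (x + y) < B.
Proof. by move=> xB yB; apply: le_lt_trans (abs_ultra absK x y) _; rewrite gt_max xB. Qed.

Lemma nrmB_le x y B : nrm x <= B -> nrm y <= B -> nrm (x - y) <= B.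
Proof. by move=> xB yB; apply: nrmD_le; rewrite ?nrmN. Qed.

Lemma nrmB_lt x y B : nrm x < B -> nrm y < B -> nrm (x - y) < B.
Proof. by move=> xB yB; apply: nrmD_lt; rewrite ?nrmN. Qed.

Lemma nrm_dist_le x y z B : nrm (x - y) <= B -> nrm (y - z) <= B -> nrm (x - z) <= B.
Proof. by move=> xy yz; rewrite -(subrKA y); apply: nrmD_le. Qed.

Lemma nrm_dist_lt x y z B : nrm (x - y) < B -> nrm (y - z) < B -> nrm (x - z) < B.
Proof. by move=> xy yz; rewrite -(subrKA y); apply: nrmD_lt. Qed.

Lemma nrm_sum_le (I : Type) (r : seq I) (P : pred I) (G : I -> K) (B : R) :
  0 <= B -> (forall i, P i -> nrm (G i) <= B) -> nrm (\sum_(i <- r | P i) G i) <= B.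
Proof.
move=> B0 GB; elim/big_rec: _ => [|i x Pi xB]; first by rewrite nrm0.
by apply: nrmD_le; rewrite ?GB.
Qed.

Lemma nrm_prod_le1 (I : Type) (r : seq I) (P : pred I) (G : I -> K) :
  (forall i, P i -> nrm (G i) <= 1) -> nrm (\prod_(i <- r | P i) G i) <= 1.
Proof.
move=> GB; elim/big_rec: _ => [|i x Pi xB]; first by rewrite nrm1.
by rewrite nrmM mulr_ile1 ?nrm_ge0 ?GB.
Qed.

Lemma nrmM_le x y B : nrm x <= 1 -> nrm y <= B -> nrm (x * y) <= B.
Proof.
move=> x1 yB; rewrite nrmM; apply: le_trans yB.
by rewrite ler_piMl ?nrm_ge0.
Qed.

Lemma nrmX_le1 x n : nrm x <= 1 -> nrm (x ^+ n) <= 1.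
Proof. by move=> x1; rewrite nrmX exprn_ile1 ?nrm_ge0. Qed.

Lemma nrm_nat_le1 n : nrm n%:R <= 1.
Proof. by elim: n => [|n IH]; rewrite ?nrm0 // -natr1 nrmD_le ?nrm1. Qed.

Lemma nrm_int_le1 (z : int) : nrm z%:~R <= 1.
Proof. by case: z => n; rewrite ?NegzE ?mulrNz ?nrmN nrm_nat_le1. Qed.

Lemma nrm_sign n : nrm ((-1) ^+ n) = 1.
Proof. by rewrite nrmX nrmN nrm1 expr1n. Qed.

(** Isosceles principle: [|x| < 1] would force [|y| = |x - (x - y)| < 1]. *)
Lemma nrm_near1 x y : nrm y = 1 -> nrm (x - y) < 1 -> nrm x = 1.
Proof.
move=> y1 xy; apply/eqP; rewrite eq_le; apply/andP; split.
  by rewrite -(subrK y x) nrmD_le ?y1 // ltW.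
rewrite leNgt; apply/negP => x1.
by have := nrmB_lt x1 xy; rewrite subKr y1 ltxx.
Qed.

Lemma nrm_expB_le x y n : nrm x <= 1 -> nrm y <= 1 -> nrm (x ^+ n - y ^+ n) <= nrm (x - y).
Proof.
move=> x1 y1; rewrite subrXX mulrC nrmM_le //.
by apply: nrm_sum_le => // i _; rewrite nrmM_le ?nrmX_le1.
Qed.

Lemma nrm_p_gt0 : 0 < nrm p%:R. Proof. by have /andP[] := abs_p absK. Qed.
Lemma nrm_p_lt1 : nrm p%:R < 1. Proof. by have /andP[] := abs_p absK. Qed.

Lemma nrm_dvd_le (m n : nat) : (m %| n)%N -> nrm n%:R <= nrm m%:R.
Proof. by case/dvdnP=> k ->; rewrite natrM nrmM_le ?nrm_nat_le1. Qed.

Lemma nrm_pX_small (e : R) : 0 < e -> exists N, forall n, (N <= n)%N -> nrm p%:R ^+ n < e.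
Proof. by apply: expr_small; rewrite ?nrm_ge0 ?nrm_p_lt1. Qed.

(** * Limits and series *)

Lemma cvgK_unique u l l' : cvgK nrm u l -> cvgK nrm u l' -> l = l'.
Proof.
move=> ul ul'; apply/eqP; rewrite -subr_eq0 -nrm_eq0 eq_le nrm_ge0 andbT leNgt.
apply/negP => /[dup] /ul[N HN] /ul'[N' HN'].
have := HN _ (leq_maxl N N'); rewrite nrm_distC => lu.
by have := nrm_dist_lt lu (HN' _ (leq_maxr N N')); rewrite ltxx.
Qed.

(** Uniqueness of limits identifies the limit chosen by [epsilon] with any limit exhibited by
    hand. *)
Lemma limK_eq u l : cvgK nrm u l -> limK nrm u = l.
Proof.
move=> ul; apply: (cvgK_unique _ ul).
by apply: (epsilon_spec (inhabits 0) (cvgK nrm u)); exists l.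
Qed.

Lemma cvgK_limK u : cauchyK nrm u -> cvgK nrm u (limK nrm u).
Proof. by case/(abs_complete absK) => l /[dup] /limK_eq ->. Qed.

Lemma cvgK_near u v l : cvgK nrm u l -> cvgK nrm (fun n => v n - u n) 0 -> cvgK nrm v l.
Proof.
move=> ul vu e e0; have [N HN] := ul e e0; have [N' HN'] := vu e e0.
exists (maxn N N') => n; rewrite geq_max => /andP[Nn N'n].
by apply: nrm_dist_lt (HN _ Nn); have := HN' _ N'n; rewrite subr0.
Qed.

Lemma cvgKD u v l l' : cvgK nrm u l -> cvgK nrm v l' -> cvgK nrm (fun n => u n + v n) (l + l').
Proof.
move=> ul ul' e e0; have [N HN] := ul e e0; have [N' HN'] := ul' e e0.
exists (maxn N N') => n; rewrite geq_max => /andP[Nn N'n].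
by rewrite opprD addrACA nrmD_lt ?HN ?HN'.
Qed.

Lemma cvgKMl c u l : cvgK nrm u l -> cvgK nrm (fun n => c * u n) (c * l).
Proof.
move=> ul; have [->|c0] := eqVneq c 0.
  by move=> e e0; exists 0%N => n _; rewrite !mul0r subrr nrm0.
move=> e e0; have [|N HN] := ul (e / nrm c); first by rewrite divr_gt0 ?nrm_gt0.
by exists N => n /HN; rewrite -mulrBr nrmM ltr_pdivlMr ?nrm_gt0 // mulrC.
Qed.

Lemma cvgK_sum (I : Type) (r : seq I) (u : I -> nat -> K) (l : I -> K) :
  (forall i, cvgK nrm (u i) (l i)) ->
  cvgK nrm (fun n => \sum_(i <- r) u i n) (\sum_(i <- r) l i).
Proof.
move=> ul; elim: r => [|i r IH].
  by move=> e e0; exists 0%N => n _; rewrite !big_nil subrr nrm0.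
move=> e e0; have [N HN] := cvgKD (ul i) IH e0.
by exists N => n Nn; rewrite !big_cons HN.
Qed.

Lemma cvgK_closed u l b B :
  cvgK nrm u l -> 0 <= B -> (exists N, forall n, (N <= n)%N -> nrm (u n - b) <= B) ->
  nrm (l - b) <= B.
Proof.
move=> ul B0 [N HN]; rewrite leNgt; apply/negP => Bl.
have [N' HN'] := ul _ (le_lt_trans B0 Bl).
have := HN' _ (leq_maxr N N'); rewrite (nrm_distC (u _)) => lu.
have ub := le_lt_trans (HN _ (leq_maxl N N')) Bl.
by have := nrm_dist_lt lu ub; rewrite ltxx.
Qed.

(** An ultrametric tail is bounded by its largest term, so null terms suffice; [e / 2] turns the
    non-strict bound on sums into a strict one. *)
Lemma cauchyK_series u : cvgK nrm u 0 -> cauchyK nrm (fun n => \sum_(k < n) u k).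
Proof.
move=> u0 e e0; have e2 : 0 < e / 2 by lra.
have [N HN] := u0 _ e2.
have tail m n : (N <= n <= m)%N -> nrm (\sum_(k < m) u k - \sum_(k < n) u k) < e.
  case/andP=> Nn nm; rewrite -!(big_mkord xpredT u) (big_cat_nat _ nm) //= addrAC subrr add0r.
  apply: (@le_lt_trans _ _ (e / 2)); last by lra.
  rewrite big_nat; apply: nrm_sum_le; first by lra.
  move=> k /andP[nk _]; have := HN k (leq_trans Nn nk); rewrite subr0; exact: ltW.
exists N => m n Nm Nn; case: (leqP n m) => [nm|/ltnW mn]; first by rewrite tail ?Nn.
by rewrite nrm_distC tail ?Nm.
Qed.

Lemma cvgK_seriesK u : cvgK nrm u 0 -> cvgK nrm (fun n => \sum_(k < n) u k) (seriesK nrm u).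
Proof. by move=> u0; apply: cvgK_limK; apply: cauchyK_series. Qed.

Lemma cvgK_dom u (b : nat -> R) :
  (forall e, 0 < e -> exists N, forall n, (N <= n)%N -> b n < e) ->
  (forall n, nrm (u n) <= b n) -> cvgK nrm u 0.
Proof.
move=> b0 ub e e0; have [N HN] := b0 e e0.
by exists N => n Nn; rewrite subr0 (le_lt_trans (ub n)) ?HN.
Qed.

Lemma nrm_series_dist_le u v B : 0 <= B -> cvgK nrm u 0 -> cvgK nrm v 0 ->
  (forall k, nrm (u k - v k) <= B) -> nrm (seriesK nrm u - seriesK nrm v) <= B.
Proof.
move=> B0 u0 v0 uvB.
have uv := cvgKD (cvgK_seriesK u0) (cvgKMl (-1) (cvgK_seriesK v0)).
rewrite mulN1r in uv; rewrite -[_ - _]subr0; apply: (cvgK_closed uv B0).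
exists 0%N => n _; rewrite subr0 mulN1r -sumrB.
exact: nrm_sum_le.
Qed.

Lemma seriesK_finite u N : (forall k, (N <= k)%N -> u k = 0) ->
  seriesK nrm u = \sum_(k < N) u k.
Proof.
move=> uN; apply: limK_eq => e e0; exists N => n Nn.
rewrite -!(big_mkord xpredT u) (big_cat_nat _ Nn) //= addrAC subrr add0r.
rewrite big_nat big1 ?nrm0 // => k /andP[Nk _]; exact: uN.
Qed.

(** * Absolute values of integers and of Euler numbers *)

Hypothesis p_pr : prime p.

(** By Bezout [u n = v p + 1], so [|n| < 1] together with [|p| < 1] would give [|1| < 1]. *)
Lemma nrm_coprime n : coprime p n -> nrm n%:R = 1.
Proof.
move=> cpn; have n0 : (0 < n)%N.
  by case: n cpn => //; rewrite /coprime gcdn0 => /eqP p1; move: p_pr; rewrite p1.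
have [u v] := egcdnP p n0; rewrite gcdnC (eqP cpn) => e _.
apply/eqP; rewrite eq_le nrm_nat_le1 /= leNgt; apply/negP => n1.
have : nrm (u * n)%:R < 1 by rewrite natrM; apply: le_lt_trans n1; rewrite nrmM_le ?nrm_nat_le1.
have : nrm (v * p)%:R < 1.
  by rewrite natrM; apply: le_lt_trans nrm_p_lt1; rewrite nrmM_le ?nrm_nat_le1.
by rewrite e natrD => h1 h2; have := nrmB_lt h2 h1; rewrite addrC addKr nrm1 ltxx.
Qed.

Lemma nrm_nat n : (0 < n)%N -> nrm n%:R = nrm p%:R ^+ logn p n.
Proof.
move=> n0; have [m cm {1}->] := pfactor_coprime p_pr n0.
by rewrite natrM nrmM nrm_coprime // mul1r natrX nrmX.
Qed.

Lemma natr_neq0 n : (0 < n)%N -> n%:R != 0 :> K.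
Proof. by move=> n0; rewrite -nrm_gt0 nrm_nat // exprn_gt0 // nrm_p_gt0. Qed.

Lemma nrm_natE n : nrm n%:R = 1 -> coprime p n.
Proof.
move=> n1; rewrite prime_coprime //; apply/negP => /nrm_dvd_le.
by rewrite n1 leNgt nrm_p_lt1.
Qed.

Hypothesis p_odd : odd p.

Lemma nrm2 : nrm 2 = 1.
Proof. by apply: nrm_coprime; rewrite coprimen2. Qed.

(** Since [p] is odd, [2] is a unit, and the recurrence preserves integrality. *)
Lemma nrm_eulerE_le1 k : nrm (ratr (eulerE k)) <= 1.
Proof.
elim/ltn_ind: k => -[|k] IH; first by rewrite (ratr_nat K 1) nrm1.
rewrite -[nrm _]mul1r -{1}nrm2 -nrmM (ratr_eulerE_recurrence natr_neq0) nrmN.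
by apply: nrm_sum_le => // j _; rewrite nrmM_le ?nrm_nat_le1 ?IH.
Qed.

(* The exponent bound [2 v_p(k!) <= k] is what makes the binomial series
   analytic in the exponent. *)
Lemma nrm_div_fact_le z k : nrm z <= nrm p%:R ->
  nrm (z ^+ k / (k`!)%:R) <= nrm p%:R ^+ (uphalf k).
Proof.
move=> zp; rewrite nrmM nrmV nrmX (nrm_nat (fact_gt0 k)).
rewrite ler_pdivrMr ?exprn_gt0 ?nrm_p_gt0 // -exprD.
apply: (@le_trans _ _ (nrm p%:R ^+ k)); first by rewrite lerXn2r ?nnegrE ?nrm_ge0.
apply: ler_wiXn2l; rewrite ?nrm_ge0 ?(ltW nrm_p_lt1) //.
by have := logn_fact_double_le k p_pr p_odd; lia.
Qed.

End AbsoluteValue.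

(** * Powers with p-adic exponents through the binomial series *)

Section PadicPowers.

Variables (K : fieldType) (R : realType) (nrm : K -> R) (p : nat).
Hypothesis absK : padic_abs p nrm.

(** Membership in the closure of the natural numbers: identities between powers [y ^+ n] extend to
    such exponents by continuity. *)
Definition nat_approximable (s : K) : Prop :=
  forall e : R, 0 < e -> exists n : nat, nrm (s - n%:R) < e.

Lemma padic_int_nat_approximable s : is_padic_int nrm s -> nat_approximable s.
Proof.
case=> u us e e0; have [N HN] := us e e0; have [M HM] := nrm_pX_small absK e0.
pose m := ((p ^ M)%N)%:Z.
have p0 : (0 < p)%N.
  by have := nrm_p_gt0 absK; case: (p) => //; rewrite (nrm0 absK) ltxx.
have m0 : m != 0 by rewrite eqz_nat expn_eq0 -leqn0 leqNgt p0.
(* The residue of [u N] modulo [p ^ M] is nonnegative and within [|p| ^ M] of [u N]. *)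
exists `|(u N %% m)%Z|%N.
apply: (nrm_dist_lt absK (y := (u N)%:~R)); first by rewrite (nrm_distC absK) HN.
rewrite {1}(divz_eq (u N) m) [X in _ - X]pmulrn gez0_abs ?modz_ge0 //.
rewrite intrD addrK intrM /m -pmulrn natrX.
apply: le_lt_trans (HM M (leqnn _)); rewrite -(nrmX absK).
by rewrite (nrmM_le absK) ?(nrm_int_le1 absK).
Qed.

Lemma is_padic_int_1B s : is_padic_int nrm s -> is_padic_int nrm (1 - s).
Proof.
case=> u us; exists (fun n => 1 - u n) => e /us[N HN]; exists N => n /HN.
by rewrite intrB opprB addrA addrAC (addrAC 1) subrr add0r (nrm_distC absK) addrC.
Qed.

Lemma is_padic_int_nat n : is_padic_int nrm n%:R.
Proof. by exists (fun=> n%:Z) => e e0; exists 0%N => m _; rewrite subrr (nrm0 absK). Qed.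

Lemma nat_approximable_nat n : nat_approximable n%:R.
Proof. by move=> e e0; exists n; rewrite subrr (nrm0 absK). Qed.

Lemma nat_approximable_le1 s : nat_approximable s -> nrm s <= 1.
Proof.
move=> /(_ 1 ltr01)[n /ltW sn]; rewrite -(subrK n%:R s).
by rewrite (nrmD_le absK) ?(nrm_nat_le1 absK).
Qed.

Lemma falling_dist_le k x y : nrm x <= 1 -> nrm y <= 1 ->
  nrm (\prod_(i < k) (x - i%:R) - \prod_(i < k) (y - i%:R)) <= nrm (x - y).
Proof.
move=> x1 y1; elim: k => [|k IH]; first by rewrite !big_ord0 subrr (nrm0 absK) (nrm_ge0 absK).
rewrite !big_ord_recr /=; set P := \prod_(i < k) _; set Q := \prod_(i < k) _.
have -> : P * (x - k%:R) - Q * (y - k%:R) = (x - k%:R) * (P - Q) + Q * (x - y) by ring.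
apply: (nrmD_le absK); apply: (nrmM_le absK) => //.
  by rewrite (nrmB_le absK) ?(nrm_nat_le1 absK).
by apply: (nrm_prod_le1 absK) => i _; rewrite (nrmB_le absK) ?(nrm_nat_le1 absK).
Qed.

Hypothesis p_pr : prime p.

Lemma fact_neq0 k : (k`!)%:R != 0 :> K.
Proof. exact: natr_neq0 absK p_pr _ (fact_gt0 k). Qed.

Lemma binomK_nat n k : binomK n%:R k = ('C(n, k))%:R :> K.
Proof.
suff ff : \prod_(i < k) (n%:R - i%:R) = (n ^_ k)%:R :> K.
  by rewrite /binomK ff -bin_ffact natrM mulfK ?fact_neq0.
elim: k => [|k IH]; first by rewrite big_ord0 ffactn0.
rewrite big_ord_recr /= IH ffactnSr natrM.
by case: (leqP k n) => [kn|nk]; [rewrite natrB | rewrite ffact_small ?mul0r].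
Qed.

Lemma binomK_dist_le k x y : nrm x <= 1 -> nrm y <= 1 ->
  nrm (binomK x k - binomK y k) <= nrm (x - y) / nrm (k`!)%:R.
Proof.
move=> x1 y1; rewrite -mulrBl (nrmM absK) (nrmV absK) ler_wpM2r ?falling_dist_le //.
by rewrite invr_ge0 (nrm_ge0 absK).
Qed.

(** Comparison with the integer [C(n, k)], where [n] is close enough to [s] for the error to absorb
    the denominator [k!]. *)
Lemma binomK_le1 s k : nat_approximable s -> nrm (binomK s k) <= 1.
Proof.
move=> sZ; have k0 : 0 < nrm (k`!)%:R by rewrite (nrm_gt0 absK) fact_neq0.
have [n sn] := sZ _ k0.
rewrite -(subrK (binomK n%:R k) (binomK s k)) (nrmD_le absK) //; last first.
  by rewrite binomK_nat (nrm_nat_le1 absK).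
apply: le_trans (binomK_dist_le _ (nat_approximable_le1 sZ) (nrm_nat_le1 absK n)) _.
by rewrite ler_pdivrMr // mul1r ltW.
Qed.

Lemma binomial_series_null s z (e : nat -> K) :
  nat_approximable s -> nrm z < 1 -> (forall k, nrm (e k) <= 1) ->
  cvgK nrm (fun k => binomK s k * z ^+ k * e k) 0.
Proof.
move=> sZ z1 e1; apply: (cvgK_dom (b := fun k => nrm z ^+ k)).
  by move=> d; apply: expr_small; rewrite ?(nrm_ge0 absK).
move=> k; rewrite -(nrmX absK) mulrC.
by rewrite (nrmM_le absK) // (nrmM_le absK) ?binomK_le1.
Qed.

Lemma ppow_series_null s y : nat_approximable s -> nrm (y - 1) < 1 ->
  cvgK nrm (fun k => binomK s k * (y - 1) ^+ k) 0.
Proof.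
move=> sZ y1 d d0; have n1 (k : nat) : nrm (1 : K) <= 1 by rewrite (nrm1 absK).
have [N HN] := binomial_series_null (e := fun=> 1) sZ y1 n1 d0.
by exists N => n /HN; rewrite mulr1.
Qed.

Lemma ppow_nat y n : ppow nrm y n%:R = y ^+ n.
Proof.
rewrite /ppow (seriesK_finite absK (N := n.+1)) => [|k nk]; last first.
  by rewrite binomK_nat bin_small // mul0r.
rewrite -[in RHS](subrK 1 y) [in RHS]addrC exprDn; apply: eq_bigr => k _.
by rewrite expr1n mul1r binomK_nat mulr_natl.
Qed.

Lemma ppow_dist1_le s y : nat_approximable s -> nrm (y - 1) < 1 ->
  nrm (ppow nrm y s - 1) <= nrm (y - 1).
Proof.
move=> sZ y1; apply: (cvgK_closed absK (cvgK_seriesK absK (ppow_series_null sZ y1))).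
  exact: nrm_ge0 absK _.
exists 1%N => -[//|n] _; rewrite big_ord_recl expr0 mulr1.
rewrite /binomK big_ord0 invr1 mulr1 addrAC subrr add0r.
apply: (nrm_sum_le absK) => [|i _]; first exact: nrm_ge0 absK _.
rewrite -/(binomK _ _) (nrmM_le absK) ?binomK_le1 // (nrmX absK) exprS.
by rewrite ler_piMr ?(nrm_ge0 absK) // exprn_ile1 ?(nrm_ge0 absK) // ltW.
Qed.

Lemma nrm_ppow s y : nat_approximable s -> nrm (y - 1) < 1 -> nrm (ppow nrm y s) = 1.
Proof.
move=> sZ y1; apply: (nrm_near1 absK (nrm1 absK)).
exact: le_lt_trans (ppow_dist1_le sZ y1) y1.
Qed.

(** Continuity in the exponent: the terms from index [m] on are small as powers of [y - 1]; the
    earlier ones are Lipschitz in the exponent, and [|m!| <= |k!|] compensates their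
    denominators. *)
Lemma ppow_approx s y e : nat_approximable s -> nrm (y - 1) < 1 -> 0 < e ->
  exists2 d : R, 0 < d &
    forall n : nat, nrm (s - n%:R) < d -> nrm (ppow nrm y s - y ^+ n) <= e.
Proof.
move=> sZ y1 e0; have [m Hm] := expr_small (nrm_ge0 absK _) y1 e0.
have m0 : 0 < nrm (m`!)%:R by rewrite (nrm_gt0 absK) fact_neq0.
exists (e * nrm (m`!)%:R) => [|n sn]; first exact: mulr_gt0.
rewrite -ppow_nat; apply: (nrm_series_dist_le absK (ltW e0)).
- exact: ppow_series_null.
- exact: ppow_series_null (nat_approximable_nat n) y1.
move=> k; rewrite -mulrBl; have y1' := ltW y1.
have sn1 := nat_approximable_le1 sZ; have n1 := nrm_nat_le1 absK n.
have nZ := nat_approximable_nat n.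
case: (leqP m k) => [mk|/ltnW km].
  rewrite (nrmM_le absK) ?(nrmB_le absK) ?binomK_le1 //.
  by rewrite (nrmX absK) ltW ?Hm.
rewrite mulrC (nrmM_le absK) ?(nrmX_le1 absK) //.
apply: le_trans (binomK_dist_le k sn1 n1) _.
rewrite ler_pdivrMr ?(nrm_gt0 absK) ?fact_neq0 //; apply: le_trans (ltW sn) _.
rewrite ler_wpM2l ?(ltW e0) // (nrm_dvd_le absK) // -(bin_fact km).
by rewrite mulnCA dvdn_mulr.
Qed.

Lemma eq_nrm_small x y : (forall e : R, 0 < e -> nrm (x - y) <= e) -> x = y.
Proof.
move=> H; apply/eqP; rewrite -subr_eq0 -(nrm_eq0 absK) eq_le (nrm_ge0 absK) andbT.
by apply/ler_addgt0Pr => e e0; rewrite add0r H.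
Qed.

Lemma mul_dist1_lt y z : nrm (y - 1) < 1 -> nrm (z - 1) < 1 -> nrm (y * z - 1) < 1.
Proof.
move=> y1 z1; have -> : y * z - 1 = y * (z - 1) + (y - 1) by ring.
apply: (nrmD_lt absK) => //; apply: le_lt_trans z1; apply: (nrmM_le absK) => //.
by rewrite (nrm_near1 absK (nrm1 absK) y1).
Qed.

(** All three powers are approximated at one common natural exponent, where the identity is
    [exprMn]. *)
Lemma ppowM s y z : nat_approximable s -> nrm (y - 1) < 1 -> nrm (z - 1) < 1 ->
  ppow nrm (y * z) s = ppow nrm y s * ppow nrm z s.
Proof.
move=> sZ y1 z1; apply: eq_nrm_small => e e0.
have [d1 d10 H1] := ppow_approx sZ y1 e0.
have [d2 d20 H2] := ppow_approx sZ z1 e0.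
have [d3 d30 H3] := ppow_approx sZ (mul_dist1_lt y1 z1) e0.
have [|n] := sZ (Num.min d1 (Num.min d2 d3)); first by rewrite !lt_min d10 d20.
rewrite !lt_min => /and3P[/H1 h1 /H2 h2 /H3 h3].
apply: (nrm_dist_le absK h3); rewrite exprMn (nrm_distC absK).
set P := ppow _ _ _ in h1 *; set Q := ppow _ _ _ in h2 *.
have -> : P * Q - y ^+ n * z ^+ n = P * (Q - z ^+ n) + z ^+ n * (P - y ^+ n) by ring.
apply: (nrmD_le absK); apply: (nrmM_le absK) => //; first by rewrite nrm_ppow.
by rewrite (nrmX_le1 absK) // (nrm_near1 absK (nrm1 absK) z1).
Qed.

Lemma ppow_inv_nat (m : nat) y : nat_approximable m%:R^-1 -> (0 < m)%N ->
  nrm (y - 1) < 1 -> ppow nrm y m%:R^-1 ^+ m = y.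
Proof.
move=> mZ m0 y1; apply: eq_nrm_small => e e0.
have mn0 := natr_neq0 absK p_pr m0.
have [d1 d10 H1] := ppow_approx mZ y1 e0.
have [d2 d20 H2] := ppow_approx (nat_approximable_nat 1) y1 e0.
have [|n] := mZ (Num.min d1 d2); first by rewrite lt_min d10.
rewrite lt_min => /andP[/H1 h1 nd2].
have y1' : nrm y <= 1 by rewrite (nrm_near1 absK (nrm1 absK) y1).
apply: (nrm_dist_le absK (y := (y ^+ n) ^+ m)).
  apply: le_trans h1; apply: (nrm_expB_le absK); last by rewrite (nrmX_le1 absK).
  by rewrite nrm_ppow.
(* Continuity at the exponent [1]: [n m] is close to [1] because [1 - n m = m (m^-1 - n)]. *)
rewrite -exprM (nrm_distC absK) -[X in X - _]expr1 -[y ^+ 1]ppow_nat; apply: H2.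
apply: le_lt_trans nd2; rewrite natrM.
have -> : 1%:R - n%:R * m%:R = m%:R * (m%:R^-1 - n%:R) :> K by rewrite mulrBr mulfV // mulrC.
by rewrite (nrmM_le absK) ?(nrm_nat_le1 absK).
Qed.

(** Bezout gives [u m = v p ^ N + 1], so [u] is within [|p| ^ N] of the inverse of [m]. *)
Lemma nat_approximable_inv m : coprime p m -> nat_approximable m%:R^-1.
Proof.
move=> cpm e e0; have [N HN] := nrm_pX_small absK e0.
have m0 : (0 < m)%N.
  by case: m cpm => //; rewrite /coprime gcdn0 => /eqP p1; move: p_pr; rewrite p1.
have mn0 := natr_neq0 absK p_pr m0.
have [u v] := egcdnP (p ^ N) m0.
have /eqP -> : gcdn m (p ^ N) == 1 by rewrite -/(coprime _ _) coprime_sym coprimeXl.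
move=> uv _; exists u; apply: le_lt_trans (HN N (leqnn _)).
have -> : m%:R^-1 - u%:R = m%:R^-1 * (1 - (u * m)%:R) :> K.
  by rewrite mulrBr mulr1 natrM mulrCA mulVf // mulr1.
rewrite (nrmM_le absK) //; first by rewrite (nrmV absK) (nrm_coprime absK) ?invr1.
rewrite uv natrD (nrm_distC absK) addrK natrM natrX -(nrmX absK).
by rewrite (nrmM_le absK) ?(nrm_nat_le1 absK).
Qed.

(** * The Teichmüller representative and the bracket of a p-adic unit *)

Section Teichmuller.

Variable a : K.
Hypotheses (aZ : is_padic_int nrm a) (a1 : nrm a = 1).

(** Fermat's little theorem, transferred from a natural number at distance less than [|p|] from
    [a]. *)
Lemma unit_expr_pred_dist1 : nrm (a ^+ p.-1 - 1) <= nrm p%:R.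
Proof.
have [n an] := padic_int_nat_approximable aZ (nrm_p_gt0 absK).
have n1 : nrm n%:R = 1.
  by apply: (nrm_near1 absK a1); rewrite (nrm_distC absK) (lt_trans an) ?(nrm_p_lt1 absK).
apply: (nrm_dist_le absK (y := n%:R ^+ p.-1)).
  by apply: le_trans (ltW an); rewrite (nrm_expB_le absK) ?n1 ?a1.
have /Euler_exp_totient : coprime n p by rewrite coprime_sym (nrm_natE absK).
rewrite totient_prime // => /eqP; rewrite eqn_mod_dvd; last first.
  by rewrite expn_gt0; move: n1; case: (n) => // /eqP; rewrite (nrm0 absK) eq_sym oner_eq0.
move/(nrm_dvd_le absK); rewrite natrB ?natrX //.
by rewrite expn_gt0; move: n1; case: (n) => // /eqP; rewrite (nrm0 absK) eq_sym oner_eq0.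
Qed.

Let coprime_pred : coprime p p.-1.
Proof. by rewrite -{1}(prednK (prime_gt0 p_pr)) coprimeSn. Qed.

Let pred_gt0 : (0 < p.-1)%N.
Proof. by have := prime_gt1 p_pr; case: (p) => [|[]]. Qed.

(* The Teichmüller representative is [a] divided by the [(p-1)]-st root of
   [a ^ (p-1)] supplied by the binomial series. *)
Lemma teichP : teich nrm p a ^+ p.-1 = 1 /\ nrm (teich nrm p a - a) < 1.
Proof.
apply: (epsilon_spec (inhabits 0) (fun w => w ^+ p.-1 = 1 /\ nrm (w - a) < 1)).
have u1 := le_lt_trans unit_expr_pred_dist1 (nrm_p_lt1 absK).
have mZ := nat_approximable_inv coprime_pred.
pose y := ppow nrm (a ^+ p.-1) (p.-1)%:R^-1.
have yX : y ^+ p.-1 = a ^+ p.-1 := ppow_inv_nat mZ pred_gt0 u1.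
have yn : nrm y = 1 by rewrite nrm_ppow.
have a0 : a != 0 by rewrite -(nrm_gt0 absK) a1.
have y0 : y != 0 by rewrite -(nrm_gt0 absK) yn.
exists (a / y); split; first by rewrite exprMn exprVn yX mulfV // expf_neq0.
have -> : a / y - a = a / y * (1 - y) by rewrite mulrBr mulr1 divfK.
rewrite !(nrmM absK) (nrmV absK) yn a1 invr1 !mul1r (nrm_distC absK).
exact: le_lt_trans (ppow_dist1_le mZ u1) u1.
Qed.

Lemma nrm_teich : nrm (teich nrm p a) = 1.
Proof. exact: (nrm_expr_eq1 absK pred_gt0 (proj1 teichP)). Qed.

Lemma bracket_dist1_lt : nrm (bracket nrm p a - 1) < 1.
Proof.
have t0 : teich nrm p a != 0 by rewrite -(nrm_gt0 absK) nrm_teich.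
have -> : bracket nrm p a - 1 = (teich nrm p a)^-1 * (a - teich nrm p a).
  by rewrite mulrBr mulVf.
rewrite (nrmM absK) (nrmV absK) nrm_teich invr1 mul1r (nrm_distC absK).
by case: teichP.
Qed.

(* Writing [b = <a>], the factor [(b^(p-1) - 1) / (b - 1)] is congruent to
   [p - 1], hence a unit, and [b^(p-1) = a^(p-1)]. *)
Lemma bracket_dist1_le : nrm (bracket nrm p a - 1) <= nrm p%:R.
Proof.
have b1 := bracket_dist1_lt; set b := bracket nrm p a in b1 *.
have bX : b ^+ p.-1 = a ^+ p.-1.
  by rewrite exprMn exprVn (proj1 teichP) invr1 mul1r.
have bn : nrm b <= 1 by rewrite (nrm_near1 absK (nrm1 absK) b1).
have := unit_expr_pred_dist1; rewrite -bX subrX1 (nrmM absK).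
rewrite [X in _ * X](nrm_near1 absK (y := (p.-1)%:R)) ?mulr1 //.
  by rewrite (nrm_coprime absK).
have -> : (p.-1)%:R = \sum_(i < p.-1) 1 :> K by rewrite sumr_const card_ord.
rewrite -sumrB; apply: le_lt_trans b1; apply: (nrm_sum_le absK); first exact: nrm_ge0 absK _.
move=> i _; rewrite -[X in nrm (_ - X)](expr1n _ i).
by rewrite (nrm_expB_le absK) ?(nrm1 absK).
Qed.

Lemma bracketD b : nrm b < 1 -> bracket nrm p (a + b) = bracket nrm p a * (1 + b / a).
Proof.
move=> b1; have a0 : a != 0 by rewrite -(nrm_gt0 absK) a1.
have -> : bracket nrm p (a + b) = (teich nrm p a)^-1 * (a + b).
  congr (_^-1 * _); rewrite /teich; congr (epsilon _ _).
  (* Adding [b] does not change the residue class, so the predicates defining [teich] at [a + b] and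
     at [a] are equal and [epsilon] picks the same root. *)
  apply: functional_extensionality => w; apply: propositional_extensionality.
  split=> -[w1 wa]; split=> //.
    rewrite (_ : w - a = (w - (a + b)) + b); last by ring.
    exact: (nrmD_lt absK wa b1).
  by rewrite opprD addrA (nrmB_lt absK).
rewrite /bracket -mulrA; congr (_ * _).
by rewrite mulrDr mulr1 mulrCA mulfV // mulr1.
Qed.

End Teichmuller.

End PadicPowers.

(** * Alternating power sums and Euler numbers *)

Section AlternatingSums.

Variables (K : fieldType) (R : realType) (nrm : K -> R) (p : nat).
Hypothesis absK : padic_abs p nrm.
Hypotheses (p_pr : prime p) (p_odd : odd p).

(** As [0 ^+ 0] is [1], the term [j = 0] counts when [k = 0]. *)
Definition alt_moment (k n : nat) : K := \sum_(j < n) (-1) ^+ j * j%:R ^+ k.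

(** By the binomial theorem the sum over [i] shifts [j] to [j + 1]; adding the unshifted sum
    telescopes, and [n] odd fixes the sign of the end term. *)
Lemma alt_moment_recurrence k n : odd n ->
  \sum_(i < k.+1) ('C(k, i))%:R * alt_moment i n + alt_moment k n = 0 ^+ k + n%:R ^+ k.
Proof.
move=> n_odd.
have -> : \sum_(i < k.+1) ('C(k, i))%:R * alt_moment i n
        = \sum_(j < n) (-1) ^+ j * (j.+1)%:R ^+ k.
  under eq_bigr => i _ do rewrite /alt_moment mulr_sumr.
  rewrite exchange_big /=; apply: eq_bigr => j _.
  rewrite -natr1 addrC exprDn mulr_sumr; apply: eq_bigr => i _.
  by rewrite expr1n mul1r mulrCA mulr_natl.
rewrite /alt_moment -big_split /=.
have -> m : \sum_(j < m) ((-1) ^+ j * (j.+1)%:R ^+ k + (-1) ^+ j * j%:R ^+ k)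
          = 0 ^+ k - (-1) ^+ m * m%:R ^+ k :> K.
  elim: m => [|m IH]; first by rewrite big_ord0 expr0 mul1r subrr.
  by rewrite big_ord_recr /= IH exprS; ring.
by rewrite -signr_odd n_odd expr1 mulN1r opprK.
Qed.

(* Both sides obey the same recurrence up to the term [n ^+ k]. *)
Lemma alt_moment_euler k n : odd n ->
  nrm (alt_moment k n - ratr (eulerE k)) <= nrm n%:R.
Proof.
move=> n_odd; elim/ltn_ind: k => -[|k] IH.
  have := alt_moment_recurrence 0 n_odd.
  rewrite big_ord1 bin0 mul1r !expr0 (ratr_nat K 1) => e.
  have n2 : 2 != 0 :> K by apply: (natr_neq0 absK p_pr (n := 2)).
  have -> : alt_moment 0 n = 1 by apply: (mulfI n2); rewrite mulr1 mulr_natl mulr2n e.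
  by rewrite subrr (nrm0 absK) (nrm_ge0 absK).
rewrite -[nrm (_ - _)]mul1r -{1}(nrm2 absK p_pr p_odd) -(nrmM absK) mulrBr.
rewrite (ratr_eulerE_recurrence (natr_neq0 absK p_pr)) opprK.
(* The top term [i = k + 1] joins the separate moment, producing the factor [2] of the Euler
   recurrence. *)
have := alt_moment_recurrence k.+1 n_odd; rewrite big_ord_recr /= binn mul1r.
rewrite [0 ^+ _]expr0n add0r -addrA -[X in _ + X]mulr2n -[alt_moment _ _ *+ 2]mulr_natl.
rewrite addrC => /(canRL (addrK _)) ->.
rewrite -addrA addrC -sumrN -big_split /=; apply: (nrmD_le absK).
  apply: (nrm_sum_le absK) => [|i _]; first exact: (nrm_ge0 absK).
  rewrite addrC -mulrBr (nrmM_le absK) ?(nrm_nat_le1 absK) // (nrm_distC absK).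
  exact: IH.
by rewrite exprSr (nrmM_le absK) ?(nrmX_le1 absK) ?(nrm_nat_le1 absK).
Qed.

Lemma sum_sign_odd n : odd n -> \sum_(j < n) (-1) ^+ j = 1 :> K.
Proof.
move=> n_odd; rewrite -(odd_double_half n) n_odd /= add1n.
elim: (n./2) => [|m IH]; first by rewrite big_ord1.
by rewrite doubleS 2!big_ord_recr /= IH !exprS; ring.
Qed.

Definition alt_ppow_sum (s z : K) (n : nat) : K :=
  \sum_(j < n) (-1) ^+ j * ppow nrm (1 + j%:R * z) s.

Variable s : K.
Hypothesis sZ : nat_approximable nrm s.

Lemma nrm_natM_lt1 j z : nrm z < 1 -> nrm (1 + j%:R * z - 1) < 1.
Proof.
move=> z1; rewrite addrAC subrr add0r; apply: le_lt_trans z1.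
by rewrite (nrmM_le absK) ?(nrm_nat_le1 absK).
Qed.

Lemma alt_ppow_sum_series z n : nrm z < 1 ->
  alt_ppow_sum s z n = seriesK nrm (fun k => binomK s k * z ^+ k * alt_moment k n).
Proof.
move=> z1; apply/esym/(limK_eq absK).
have cj (j : 'I_n) := cvgKMl absK ((-1) ^+ j) (cvgK_seriesK absK
  (ppow_series_null absK p_pr sZ (nrm_natM_lt1 j z1))).
have sw := cvgK_sum absK (index_enum 'I_n) cj.
move=> e e0; have [N HN] := sw e e0; exists N => m /HN; congr (nrm (_ - _) < _).
under eq_bigr => j _ do rewrite mulr_sumr.
rewrite exchange_big /=; apply: eq_bigr => k _.
rewrite /alt_moment mulr_sumr; apply: eq_bigr => j _.
by rewrite [1 + _ - 1]addrAC subrr add0r exprMn; ring.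
Qed.

Lemma nrm_alt_moment_le1 k n : nrm (alt_moment k n) <= 1.
Proof.
apply: (nrm_sum_le absK) => // j _.
by rewrite (nrmM_le absK) ?(nrm_sign absK) ?(nrmX_le1 absK) ?(nrm_nat_le1 absK).
Qed.

(** Termwise comparison: the bound [|n|] on the moments is uniform in [k], and the coefficients
    [binomK s k * z ^+ k] are integral. *)
Lemma alt_ppow_sum_euler z n : nrm z < 1 -> odd n ->
  nrm (alt_ppow_sum s z n - seriesK nrm (fun k => binomK s k * z ^+ k * ratr (eulerE k)))
    <= nrm n%:R.
Proof.
move=> z1 n_odd; rewrite alt_ppow_sum_series //.
apply: (nrm_series_dist_le absK).
- exact: (nrm_ge0 absK).
- apply: (binomial_series_null absK p_pr sZ z1) => k; exact: nrm_alt_moment_le1.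
- apply: (binomial_series_null absK p_pr sZ z1) => k; exact: (nrm_eulerE_le1 absK).
move=> k; rewrite -mulrBr (nrmM_le absK) ?alt_moment_euler // (nrmM_le absK) //.
  exact: (binomK_le1 absK).
by rewrite (nrmX_le1 absK) // ltW.
Qed.

(** For [n] odd the signs sum to [1], so [1] can be subtracted from each power separately. *)
Lemma alt_ppow_sum_dist1 z n : nrm z < 1 -> odd n ->
  nrm (alt_ppow_sum s z n - 1) <= nrm z.
Proof.
move=> z1 n_odd; rewrite -(sum_sign_odd n_odd) -sumrB.
apply: (nrm_sum_le absK) => [|j _]; first exact: (nrm_ge0 absK).
rewrite -[X in _ - X]mulr1 -mulrBr (nrmM_le absK) ?(nrm_sign absK) //.
apply: le_trans (ppow_dist1_le absK p_pr sZ (nrm_natM_lt1 j z1)) _.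
by rewrite addrAC subrr add0r (nrmM_le absK) ?(nrm_nat_le1 absK).
Qed.

End AlternatingSums.

(** * Twisted sums cut into blocks *)

Lemma sum_blocks (V : zmodType) (G : nat -> V) (M n : nat) :
  \sum_(1 <= a < (M * n).+1) G a = \sum_(j < n) \sum_(1 <= a < M.+1) G (a + j * M)%N.
Proof.
elim: n => [|n IH]; first by rewrite muln0 big_geq // big_ord0.
rewrite big_ord_recr /= -IH (big_cat_nat (n := (M * n).+1)) //=; last first.
  by rewrite ltnS leq_mul2l leqnSn orbT.
have -> : ((M * n).+1 = 1 + n * M)%N by rewrite mulnC.
have bound : ((M * n.+1).+1 - n * M = M.+1)%N by rewrite mulnS (mulnC n M); lia.
by rewrite [in LHS]big_addn bound; congr (_ + _); rewrite mulnC.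
Qed.

Section TwistedSums.

Variables (K : fieldType) (R : realType) (nrm : K -> R) (p f : nat) (chi : nat -> K).
Hypothesis absK : padic_abs p nrm.
Hypotheses (p_pr : prime p) (p_odd : odd p) (chiP : dirichlet_char f chi).

Lemma dirichlet_char_addM a k : chi (a + k * f)%N = chi a.
Proof.
case: chiP => _ chiD _ _ _; elim: k => [|k IH]; first by rewrite mul0n addn0.
by rewrite mulSn addnCA addnC chiD.
Qed.

(** Nonzero values are roots of unity, by Euler's theorem modulo [f]. *)
Lemma nrm_dirichlet_char_le1 a : nrm (chi a) <= 1.
Proof.
case: (chiP) => f0 chiD chiM chi1 chi0.
case: (boolP (coprime a f)) => [cp|]; last by rewrite -chi0 => /eqP ->; rewrite (nrm0 absK).
have chiX n : chi (a ^ n)%N = chi a ^+ n.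
  by elim: n => [|n IH]; rewrite ?expn0 ?chi1 // expnS chiM IH exprS.
have chi_mod b : chi (b %% f)%N = chi b by rewrite {2}(divn_eq b f) addnC dirichlet_char_addM.
have tf0 : (0 < totient f)%N by rewrite totient_gt0.
by rewrite (nrm_expr_eq1 absK tf0) // -chiX -chi_mod Euler_exp_totient // chi_mod.
Qed.

Variable s : K.
Hypothesis sZ : nat_approximable nrm s.

Definition twisted_sum (M : nat) : K :=
  \sum_(1 <= a < M.+1 | ~~ (p %| a)%N)
    (-1) ^+ a * chi a * ppow nrm (bracket nrm p a%:R) s.

Lemma nrm_prime_unit a : ~~ (p %| a)%N -> nrm a%:R = 1.
Proof. by move=> pa; rewrite (nrm_coprime absK p_pr) // prime_coprime. Qed.

Lemma nrm_div_unit_lt1 M a : (p %| M)%N -> ~~ (p %| a)%N -> nrm (M%:R / a%:R) < 1.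
Proof.
move=> pM pa; rewrite (nrmM absK) (nrmV absK) (nrm_prime_unit pa) invr1 mulr1.
by apply: le_lt_trans (nrm_p_lt1 absK); apply: (nrm_dvd_le absK).
Qed.

Lemma ppow_bracketD a j M : (p %| M)%N -> ~~ (p %| a)%N ->
  ppow nrm (bracket nrm p (a + j * M)%:R) s
  = ppow nrm (bracket nrm p a%:R) s * ppow nrm (1 + j%:R * (M%:R / a%:R)) s.
Proof.
move=> pM pa; have aZ := is_padic_int_nat absK a; have a1 := nrm_prime_unit pa.
rewrite natrD (bracketD absK) //; last first.
  by apply: le_lt_trans (nrm_p_lt1 absK); apply: (nrm_dvd_le absK); rewrite dvdn_mull.
rewrite (ppowM absK p_pr sZ) ?natrM ?mulrA //; first exact: (bracket_dist1_lt absK).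
rewrite -mulrA; apply: (nrm_natM_lt1 absK); exact: nrm_div_unit_lt1.
Qed.

(** Along [a + j M], divisibility of [M] by [p] preserves the summation condition, divisibility by
    [f] preserves [chi], and [M] odd makes the sign that of [a + j]. *)
Lemma twisted_sum_blocks M n : odd M -> (p %| M)%N -> (f %| M)%N ->
  twisted_sum (M * n) = \sum_(1 <= a < M.+1 | ~~ (p %| a)%N)
    (-1) ^+ a * chi a * (ppow nrm (bracket nrm p a%:R) s * alt_ppow_sum nrm s (M%:R / a%:R) n).
Proof.
move=> M_odd pM /dvdnP[k Mk]; rewrite /twisted_sum big_mkcond sum_blocks exchange_big /=.
rewrite [RHS]big_mkcond; apply: eq_bigr => a _.
have pD j : (p %| a + j * M)%N = (p %| a)%N by rewrite dvdn_addl // dvdn_mull.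
under eq_bigr => j _ do rewrite pD.
case: ifPn => [pa|_]; last by rewrite big1.
rewrite /alt_ppow_sum !mulr_sumr; apply: eq_bigr => j _.
rewrite ppow_bracketD // {2}Mk mulnA dirichlet_char_addM.
have -> : (-1) ^+ (a + j * M) = (-1) ^+ a * (-1) ^+ j :> K.
  by rewrite exprD -[(-1) ^+ (j * M)]signr_odd oddM M_odd andbT signr_odd.
by ring.
Qed.

(** The model [h] is left free: it will be the Euler series for blocks of length [F], and the
    constant [1] for blocks of length [f p ^ n]. *)
Lemma twisted_sum_dist_le M n (h : nat -> K) (B : R) :
  odd M -> (p %| M)%N -> (f %| M)%N -> 0 <= B ->
  (forall a, ~~ (p %| a)%N -> nrm (alt_ppow_sum nrm s (M%:R / a%:R) n - h a) <= B) ->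
  nrm (twisted_sum (M * n) - \sum_(1 <= a < M.+1 | ~~ (p %| a)%N)
    (-1) ^+ a * chi a * (ppow nrm (bracket nrm p a%:R) s * h a)) <= B.
Proof.
move=> M_odd pM fM B0 hB; rewrite twisted_sum_blocks // -sumrB.
apply: (nrm_sum_le absK) => // a pa; rewrite -!mulrBr.
rewrite (nrmM_le absK) //.
  by rewrite (nrmM_le absK) ?(nrm_sign absK) ?nrm_dirichlet_char_le1.
rewrite (nrmM_le absK) ?hB // (nrm_ppow absK p_pr sZ) //.
by apply: (bracket_dist1_lt absK p_pr (is_padic_int_nat absK a)); apply: nrm_prime_unit.
Qed.

Lemma cvgK_twisted_sum F : odd F -> (p %| F)%N -> (f %| F)%N ->
  cvgK nrm (fun N => twisted_sum (f * p ^ N))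
    (\sum_(1 <= a < F.+1 | ~~ (p %| a)%N) (-1) ^+ a * chi a *
       (ppow nrm (bracket nrm p a%:R) s *
        seriesK nrm (fun k => binomK s k * (F%:R / a%:R) ^+ k * ratr (eulerE k)))).
Proof.
move=> F_odd pF fF e e0; have [N HN] := nrm_pX_small absK e0.
(* Taking [n >= 1] makes the block length [f p ^ n] divisible by [p]. *)
exists (maxn N 1) => n; rewrite geq_max => /andP[Nn n1].
apply: le_lt_trans (HN n Nn).
have f_odd : odd f by move: F_odd; rewrite -(divnK fF) oddM => /andP[].
have q_odd : odd (F %/ f) by move: F_odd; rewrite -{1}(divnK fF) oddM => /andP[].
have pX0 : 0 <= nrm p%:R ^+ n by rewrite exprn_ge0 ?(nrm_ge0 absK).
have pn_odd : odd (p ^ n) by rewrite oddX p_odd orbT.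
have p_pn : (p %| p ^ n)%N by rewrite -(prednK n1) expnS dvdn_mulr.
apply: (nrm_dist_le absK (y := twisted_sum (F * p ^ n))); last first.
  apply: (twisted_sum_dist_le F_odd pF fF pX0) => a pa.
  rewrite -(nrmX absK) -natrX; apply: (alt_ppow_sum_euler absK) => //.
  exact: nrm_div_unit_lt1.
(* The length [F p ^ n] is now read as [F / f] blocks of length [f p ^ n]. *)
rewrite (nrm_distC absK) -{1}(divnK fF) mulnC mulnA.
have -> : (p ^ n * (F %/ f) * f = f * p ^ n * (F %/ f))%N by rewrite mulnC mulnA.
rewrite [X in _ - X](_ : _ = \sum_(1 <= a < (f * p ^ n).+1 | ~~ (p %| a)%N)
    (-1) ^+ a * chi a * (ppow nrm (bracket nrm p a%:R) s * 1)); last first.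
  by apply: eq_bigr => a _; rewrite mulr1.
apply: twisted_sum_dist_le => //.
- by rewrite oddM f_odd.
- by rewrite dvdn_mull.
- by rewrite dvdn_mulr.
move=> a pa; have z1 : nrm ((f * p ^ n)%:R / a%:R) < 1.
  by apply: nrm_div_unit_lt1; rewrite ?dvdn_mull.
apply: le_trans (alt_ppow_sum_dist1 absK p_pr sZ z1 q_odd) _.
rewrite (nrmM absK) (nrmV absK) (nrm_prime_unit pa) invr1 mulr1 -(nrmX absK) -natrX.
by rewrite (nrm_dvd_le absK) // dvdn_mull.
Qed.

End TwistedSums.

(** * Analyticity in [s] through the Gauss norm *)

Section Analyticity.

Variables (K : fieldType) (R : realType) (nrm : K -> R) (p : nat).
Hypothesis absK : padic_abs p nrm.

Definition gauss_le (q : {poly K}) (B : R) : Prop := forall j, nrm q`_j <= B.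

Definition gauss_cauchy (A : nat -> {poly K}) : Prop :=
  forall e : R, 0 < e -> exists N : nat,
    forall m n, (N <= m)%N -> (N <= n)%N -> gauss_le (A m - A n) e.

Lemma gauss_leM q r B : gauss_le q 1 -> gauss_le r B -> 0 <= B -> gauss_le (q * r) B.
Proof.
by move=> q1 rB B0 j; rewrite coefM; apply: (nrm_sum_le absK) => // i _; apply: (nrmM_le absK).
Qed.

Lemma nrm_horner_le q B s : gauss_le q B -> 0 <= B -> nrm s <= 1 -> nrm q.[s] <= B.
Proof.
move=> qB B0 s1; rewrite horner_coef; apply: (nrm_sum_le absK) => // i _.
by rewrite mulrC (nrmM_le absK) ?(nrmX_le1 absK).
Qed.

Lemma gauss_cauchyM A B : (forall n, gauss_le (A n) 1) -> (forall n, gauss_le (B n) 1) ->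
  gauss_cauchy A -> gauss_cauchy B -> gauss_cauchy (fun n => A n * B n).
Proof.
move=> A1 B1 cA cB e e0; have [N HN] := cA e e0; have [N' HN'] := cB e e0.
exists (maxn N N') => m n; rewrite !geq_max => /andP[Nm N'm] /andP[Nn N'n] j.
have -> : A m * B m - A n * B n = A m * (B m - B n) + B n * (A m - A n) by ring.
rewrite coefD; apply: (nrmD_le absK); apply: gauss_leM (ltW e0) j => //.
- exact: HN'.
- exact: HN.
Qed.

(** The power series has as coefficients the limits of those of [A n], which do not involve [s]; the
    Gauss norm controls all of them at once. *)
Lemma gauss_cauchy_limit A : gauss_cauchy A ->
  exists c : nat -> K, forall s l, nrm s <= 1 ->
    cvgK nrm (fun n => (A n).[s]) l -> cvgK nrm (fun n => \sum_(k < n) c k * s ^+ k) l.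
Proof.
move=> cA; exists (fun j => limK nrm (fun n => (A n)`_j)) => s l s1 Al.
have coef_cvg j : cvgK nrm (fun n => (A n)`_j) (limK nrm (fun n => (A n)`_j)).
  apply: (cvgK_limK absK) => e e0; have e2 : 0 < e / 2 by lra.
  have [N HN] := cA _ e2; exists N => m n Nm Nn.
  by have := HN m n Nm Nn j; rewrite coefB => /le_lt_trans -> //; lra.
apply: (cvgK_near absK Al) => e e0; have e2 : 0 < e / 2 by lra.
(* Once [n] reaches [size (A N)], truncating [A N] to its first [n] coefficients loses nothing, so
   the sums compare coefficient by coefficient. *)
have [N HN] := cA _ e2; exists (maxn N (size (A N))) => n.
rewrite geq_max subr0 => /andP[Nn sn].
apply: (@le_lt_trans _ _ (e / 2)); last by lra.
apply: (nrm_dist_le absK (y := (A N).[s])); last first.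
  rewrite -hornerN -hornerD; apply: nrm_horner_le; rewrite ?(ltW e2) //.
  by apply: HN.
rewrite (horner_coef_wide _ sn) -sumrB; apply: (nrm_sum_le absK); first exact: ltW.
move=> k _; rewrite -mulrBl mulrC (nrmM_le absK) ?(nrmX_le1 absK) //.
apply: (cvgK_closed absK (coef_cvg k) (ltW e2)); exists N => m Nm.
by rewrite -coefB; apply: HN.
Qed.

(** The numerator of [binomK (1 - s) k], as a polynomial in [s]. *)
Definition falling_poly (k : nat) : {poly K} := \prod_(i < k) ((1 - i%:R)%:P - 'X).

Lemma horner_falling_poly k s : (falling_poly k).[s] = \prod_(i < k) (1 - s - i%:R).
Proof.
rewrite horner_prod; apply: eq_bigr => i _.
by rewrite hornerD hornerN hornerX hornerC addrAC.
Qed.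

Lemma gauss_le_falling_poly k : gauss_le (falling_poly k) 1.
Proof.
rewrite /falling_poly; elim/big_rec: _ => [|i q _ q1].
  by move=> j; rewrite coef1 (nrm_nat_le1 absK).
apply: gauss_leM => // j; rewrite coefB coefC coefX (nrmB_le absK) ?(nrm_nat_le1 absK) //.
case: (j == 0%N); last by rewrite (nrm0 absK).
by rewrite (nrmB_le absK) ?(nrm1 absK) ?(nrm_nat_le1 absK).
Qed.

Hypotheses (p_pr : prime p) (p_odd : odd p).

Section BinomialSeries.

Variables (z : K) (b : nat -> K).
Hypotheses (zp : nrm z <= nrm p%:R) (b1 : forall k, nrm (b k) <= 1).

(** Weights [b = 1] with [z = <a> - 1] give the partial sums of the power in [H_p]; Euler numbers
    with [z = F / a] give those of its series. *)
Definition binomial_poly (n : nat) : {poly K} :=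
  \sum_(k < n) (b k * (z ^+ k / (k`!)%:R)) *: falling_poly k.

Lemma horner_binomial_poly n s :
  (binomial_poly n).[s] = \sum_(k < n) binomK (1 - s) k * z ^+ k * b k.
Proof.
rewrite horner_sum; apply: eq_bigr => k _; rewrite hornerZ horner_falling_poly /binomK.
by ring.
Qed.

Lemma gauss_le_binomial_term k :
  gauss_le ((b k * (z ^+ k / (k`!)%:R)) *: falling_poly k) (nrm p%:R ^+ uphalf k).
Proof.
move=> j; rewrite coefZ mulrC (nrmM_le absK) ?gauss_le_falling_poly //.
by rewrite (nrmM_le absK) // (nrm_div_fact_le absK).
Qed.

Lemma gauss_le_binomial_poly n : gauss_le (binomial_poly n) 1.
Proof.
move=> j; rewrite coef_sum; apply: (nrm_sum_le absK) => // k _.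
apply: le_trans (gauss_le_binomial_term k j) _.
by rewrite exprn_ile1 ?(nrm_ge0 absK) ?(ltW (nrm_p_lt1 absK)).
Qed.

Lemma gauss_cauchy_binomial_poly : gauss_cauchy binomial_poly.
Proof.
move=> e e0; have [N HN] := nrm_pX_small absK e0.
(* For [k >= 2 N] the exponent [uphalf k] is at least [N]. *)
have tail m n : (N.*2 <= n <= m)%N -> gauss_le (binomial_poly m - binomial_poly n) e.
  case/andP=> Nn nm j; rewrite /binomial_poly.
  rewrite -!(big_mkord xpredT (fun k => (b k * (z ^+ k / (k`!)%:R)) *: falling_poly k)).
  rewrite (big_cat_nat _ nm) //= addrAC subrr add0r big_nat coef_sum.
  apply: (nrm_sum_le absK) => [|k /andP[nk _]]; first exact: ltW.
  apply: le_trans (gauss_le_binomial_term k j) _; apply/ltW/HN.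
  by have := leq_trans Nn nk; lia.
exists N.*2 => m n Nm Nn; case: (leqP n m) => [nm|/ltnW mn]; first by apply: tail; rewrite Nn.
by move=> j; rewrite -opprB coefN (nrmN absK); apply: tail; rewrite Nm.
Qed.

End BinomialSeries.

Lemma cvgKM u v l l' : (forall n, nrm (u n) <= 1) -> cvgK nrm u l -> cvgK nrm v l' ->
  cvgK nrm (fun n => u n * v n) (l * l').
Proof.
move=> u1 ul vl'; have := cvgKMl absK l' ul; rewrite mulrC => ull'.
apply: (cvgK_near absK ull') => e /vl'[N HN]; exists N => n /HN; rewrite subr0.
by apply: le_lt_trans; rewrite [l' * _]mulrC -mulrBr (nrmM_le absK).
Qed.

(* Both factors of [H_p] are limits, in the Gauss norm, of polynomials in [s]
   with integral coefficients; so is their product. *)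
Lemma Hp_analytic (F : nat) (a : K) : (p %| F)%N -> is_padic_int nrm a -> nrm a = 1 ->
  exists c : nat -> K, forall s : K, is_padic_int nrm s ->
    cvgK nrm (fun n => \sum_(k < n) c k * s ^+ k) (Hp nrm p s a F).
Proof.
move=> pF aZ a1; pose y := bracket nrm p a - 1; pose z := F%:R / a.
have yp : nrm y <= nrm p%:R := bracket_dist1_le absK p_pr aZ a1.
have zp : nrm z <= nrm p%:R.
  by rewrite (nrmM absK) (nrmV absK) a1 invr1 mulr1 (nrm_dvd_le absK).
have o1 (k : nat) : nrm (1 : K) <= 1 by rewrite (nrm1 absK).
have E1 k : nrm (ratr (eulerE k)) <= 1 := nrm_eulerE_le1 absK p_pr p_odd k.
pose A := binomial_poly y (fun=> 1); pose B := binomial_poly z (fun k => ratr (eulerE k)).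
have A1 n : gauss_le (A n) 1 by apply: gauss_le_binomial_poly.
have B1 n : gauss_le (B n) 1 by apply: gauss_le_binomial_poly.
have [c Hc] := gauss_cauchy_limit (gauss_cauchyM A1 B1
  (gauss_cauchy_binomial_poly yp o1) (gauss_cauchy_binomial_poly zp E1)).
exists c => s sZ; have tZ := padic_int_nat_approximable absK (is_padic_int_1B absK sZ).
have s1 := nat_approximable_le1 absK (padic_int_nat_approximable absK sZ).
have lt1 x : nrm x <= nrm p%:R -> nrm x < 1 by move/le_lt_trans; apply; exact: (nrm_p_lt1 absK).
apply: Hc => //.
suff : cvgK nrm (fun n => (A n).[s] * (B n).[s]) (Hp nrm p s a F).
  by move=> + e e0 => /(_ e e0)[N HN]; exists N => n /HN; rewrite hornerM.
apply: cvgKM => [n||].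
- by apply: nrm_horner_le.
- move=> e e0; have [N HN] := cvgK_seriesK absK (ppow_series_null absK p_pr tZ (lt1 _ yp)) e0.
  exists N => n /HN; congr (nrm (_ - _) < _); rewrite horner_binomial_poly.
  by apply: eq_bigr => k _; rewrite mulr1.
- move=> e e0.
  have [N HN] := cvgK_seriesK absK (binomial_series_null absK p_pr tZ (lt1 _ zp) E1) e0.
  by exists N => n /HN; congr (nrm (_ - _) < _); rewrite horner_binomial_poly.
Qed.

End Analyticity.

Theorem theorem3p9 (K : fieldType) (R : realType) (nrm : K -> R)
    (p f F : nat) (chi : nat -> K) :
  padic_abs p nrm ->
  prime p -> odd p ->
  dirichlet_char f chi -> primitive_char f chi -> odd f ->
  (0 < F)%N -> odd F -> (p %| F)%N -> (f %| F)%N ->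
  (* l_{p,E}(s,chi) = sum_{a=1, p !| a}^F (-1)^a chi(a) H_p(s,a,F) for s in Z_p *)
  (forall s : K, is_padic_int nrm s ->
     cvgK nrm (ellE_partial nrm p f chi s)
       (\sum_(1 <= a < F.+1 | ~~ (p %| a)%N)
          (-1) ^+ a * chi a * Hp nrm p s a%:R F)) /\
  (* for a in Z_p^x, the series defining H_p converges on Z_p and H_p(s,a,F)
     is analytic in s : given on Z_p by a convergent power series *)
  (forall a : K, is_padic_int nrm a -> nrm a = 1 ->
     (forall s : K, is_padic_int nrm s ->
        cauchyK nrm (fun n => \sum_(k < n)
          binomK (1 - s) k * (F%:R / a) ^+ k * ratr (eulerE k))) /\
     exists c : nat -> K, forall s : K, is_padic_int nrm s ->
       cvgK nrm (fun n => \sum_(k < n) c k * s ^+ k) (Hp nrm p s a F)).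
Proof.
move=> absK p_pr p_odd chiP _ _ _ F_odd pF fF; split=> [s sZ|a aZ a1].
  have tZ := padic_int_nat_approximable absK (is_padic_int_1B absK sZ).
  exact: (cvgK_twisted_sum absK p_pr p_odd chiP tZ F_odd pF fF).
split=> [s sZ|]; last exact: (Hp_analytic absK p_pr p_odd pF aZ a1).
have tZ := padic_int_nat_approximable absK (is_padic_int_1B absK sZ).
have z1 : nrm (F%:R / a) < 1.
  rewrite (nrmM absK) (nrmV absK) a1 invr1 mulr1.
  exact: le_lt_trans (nrm_dvd_le absK pF) (nrm_p_lt1 absK).
have E1 k : nrm (ratr (eulerE k)) <= 1 := nrm_eulerE_le1 absK p_pr p_odd k.
exact: (cauchyK_series absK (binomial_series_null absK p_pr tZ z1 E1)).
Qed.
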